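(* Let $\beta$ be strictly increasing. For the penalty function $F_\lambda$ to be globally exact it is necessary and sufficient that the following assumptions hold true: (1) there exists a globally optimal solution of the problem $(\mathcal{P})$; (2) the optimal value function $h$ is $\beta$-calm from below at $\mu_0$; (3) there exists $\lambda_0 \ge 0$ such that $F_{\lambda_0}$ is bounded below on the set $A \times P$.
   Context: Setting. Let $X$ be a topological space, $f \colon X \to \mathbb{R} \cup \{+\infty\}$ a given function, and $M, A \subset X$ nonempty sets with $M \cap A \neq \emptyset$. The problem $(\mathcal{P})$ is: minimize $f(x)$ subject to $x \in M$, $x \in A$. Its set of feasible points is $\Omega = M \cap A$, and a globally optimal solution of $(\mathcal{P})$ is a point of global minimum of $f$ on $\Omega$. It is assumed that $f$ is bounded below on $\Omega$. Write $\mathbb{R}_+ = [0,+\infty)$. Let $(P,d)$ be a metric space (of perturbation parameters), and let $g \colon X \times P \to \mathbb{R} \cup \{+\infty\}$ be a perturbed objective function such that there exists $\mu_0 \in P$ for which the following conditions are satisfied: (i) (consistency condition) $g(x,\mu_0) = f(x)$ for any $x \in \Omega$; (ii) (exact penalization condition) $\operatorname{arg\,min}_{x \in A} g(x,\mu_0) = \operatorname{arg\,min}_{x \in \Omega} f(x)$. Let $\beta \colon \mathbb{R}_+ \to \mathbb{R}_+ \cup \{+\infty\}$ be a function such that $\beta(t) = 0$ if and only if $t = 0$. For any $\lambda \ge 0$ the penalty function is $$F_\lambda(x,\mu) = g(x,\mu) + \lambda \beta(d(\mu,\mu_0)),$$ and the penalized problem is to minimize $F_\lambda(x,\mu)$ over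 $(x,\mu) \in A \times P$. Global exactness: the penalty function $F_\lambda$ is said to be (globally) exact if there exists $\lambda \ge 0$ such that $F_\lambda$ attains a global minimum on the set $A \times P$, and if $(x^*,\mu^* ) \in A \times P$ is a globally optimal solution of the penalized problem, then $\mu^* = \mu_0$. Optimal value function: $h(\mu) = \inf_{x \in A} g(x,\mu)$ for $\mu \in P$. It is called $\beta$-calm from below at $\mu_0$ if $$\liminf_{\mu \to \mu_0} \frac{h(\mu) - h(\mu_0)}{\beta(d(\mu,\mu_0))} > -\infty.$$ *)

(* Defs.v *)
From mathcomp Require Import all_boot all_order all_algebra.
From mathcomp Require Import all_classical all_reals all_analysis.

Set Implicit Arguments.
Unset Strict Implicit.
Unset Printing Implicit Defensive.

Import Order.TTheory GRing.Theory Num.Theory.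
Import numFieldNormedType.Exports.

Local Open Scope classical_set_scope.
Local Open Scope ring_scope.
Local Open Scope ereal_scope.

(* As is standard for extended-real-valued functions in variational analysis,
   argmin is empty when phi is identically +oo on S: a globally optimal solution
   has a finite objective value. When phi is finite somewhere on S, the clause
   phi x < +oo is redundant. *)
Definition argmin (R : realType) (T : Type) (S : set T) (phi : T -> \bar R)
  : set T :=
  [set x | [/\ S x, phi x < +oo & forall y, S y -> phi x <= phi y]].

Definition bounded_below_on (R : realType) (T : Type) (S : set T)
    (phi : T -> \bar R) : Prop :=
  exists c : R, forall x, S x -> c%:E <= phi x.

(* The values of beta at negative reals are never used. If beta t = +oo, then
   lambda * beta t is 0 for lambda = 0 and +oo for lambda > 0. *)
Definition penalty (R : realType) (X : Type) (P : metricType R)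
    (g : X -> P -> \bar R) (beta : R -> \bar R) (mu0 : P) (lambda : R)
    (z : X * P) : \bar R :=
  g z.1 z.2 + lambda%:E * beta (mdist z.2 mu0).

Definition globally_exact (R : realType) (X : Type) (P : metricType R)
    (A : set X) (g : X -> P -> \bar R) (beta : R -> \bar R) (mu0 : P) : Prop :=
  exists lambda : R,
    [/\ (0 <= lambda)%R,
        argmin (A `*` setT) (penalty g beta mu0 lambda) !=set0
      & forall z, argmin (A `*` setT) (penalty g beta mu0 lambda) z ->
          z.2 = mu0].

Definition optimal_value (R : realType) (X : Type) (P : metricType R)
    (A : set X) (g : X -> P -> \bar R) (mu : P) : \bar R :=
  ereal_inf [set g x mu | x in A].

(* The liminf is over the punctured neighbourhoods mu0^' of mu0, the quotient
   being 0 / 0 at mu0. It is +oo when mu0 is an isolated point of P. *)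
Definition calm_from_below (R : realType) (P : metricType R)
    (beta : R -> \bar R) (mu0 : P) (h : P -> \bar R) : Prop :=
  -oo < limf_einf (fun mu => (h mu - h mu0) / beta (mdist mu mu0)) mu0^'.

(* Main.v *)
Require Import Defs.
From mathcomp Require Import all_boot all_order all_algebra.
From mathcomp Require Import all_classical all_reals all_analysis.
From mathcomp Require Import lra.

Import Order.TTheory GRing.Theory Num.Theory.
Import numFieldNormedType.Exports.

Local Open Scope classical_set_scope.
Local Open Scope ring_scope.
Local Open Scope ereal_scope.

(** Write h for the optimal value function and d for the distance to [mu0].

    Exactness amounts to one inequality: there are a minimizer x0 of
    [g ^~ mu0] on [A] and a multiplier lambda for which
    g(x0, mu0) <= F_lambda(x, mu) on all of A x P ([globally_exactP]). An
    exact penalty function gives this at once, because its minimizers lie over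
    [mu0], where the penalty term vanishes. Conversely, under the inequality
    (x0, mu0) minimizes F_lambda. Passing to F_(lambda + 1) keeps its value
    there but adds beta(d(mu)) > 0 at every point with mu != mu0, which puts the
    value at such a point strictly above the minimum; hence all minimizers of
    F_(lambda + 1) lie over [mu0].

    Calmness is the same inequality for mu close to [mu0]: after clearing the
    denominator, a lower bound - lambda on the quotient reads
    h(mu0) <= h(mu) + lambda * beta(d(mu)) ([calm_from_belowP]). So the global
    inequality implies calmness, and it also says that F_lambda is bounded
    below.

    For the converse, calmness provides a multiplier on a ball of radius delta
    around [mu0]. Outside the ball beta(d(mu)) >= beta(delta) > 0 by
    monotonicity, hence a lower bound of F_lambda0 is lifted above h(mu0) by
    adding a large enough multiple of beta(d(mu)). The larger of the two
    multipliers works everywhere ([penalty_ge_near_to_global]).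

    Finally, exact penalization identifies the minimizers of [g ^~ mu0] on [A]
    with the solutions of the original problem. *)

Lemma limf_einf_gtNyP (R : realType) (T : choiceType) (X : filteredType T)
    (u : X -> \bar R) (F : set_system X) (FF : Filter F) :
  -oo < limf_einf u F <-> exists c : R, \forall x \near F, c%:E <= u x.
Proof.
rewrite limf_einfE; split=> [/ereal_sup_gt[_ [V FV <-] infV]|[c Fc]].
- have [c cinf] : exists c : R, c%:E <= ereal_inf (u @` V).
    case: (ereal_inf _) infV => [r| |]// _; first by exists r.
    by exists 0%R; rewrite leey.
  exists c; apply: filterS FV => x Vx; apply: le_trans cinf _.
  by apply: ereal_inf_lbound; exists x.
- apply: lt_le_trans (ltNyr c) _.
  apply: (@le_trans _ _ (ereal_inf (u @` [set x | c%:E <= u x]))).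
    by apply: le_ereal_inf_tmp => _ [x cx <-].
  by apply: ereal_sup_ubound; exists [set x | c%:E <= u x].
Qed.

(** The value at t lies strictly below the value at t + 1, hence below +oo. *)
Lemma fin_num_strictly_increasing (R : realType) (beta : R -> \bar R)
    (beta_ge0 : forall t : R, (0 <= t)%R -> 0 <= beta t)
    (beta_incr : forall s t : R, (0 <= s)%R -> (s < t)%R -> beta s < beta t)
    (t : R) :
  (0 <= t)%R -> beta t \is a fin_num.
Proof.
move=> t0; rewrite ge0_fin_numE ?beta_ge0//.
by rewrite (lt_le_trans (beta_incr t (t + 1)%R t0 _)) ?leey// ltrDl.
Qed.

Lemma lee_difference_quotient (R : realType) (a b x : \bar R) (c : R) :
  a \is a fin_num -> b \is a fin_num -> 0 < b ->
  (c%:E <= (x - a) / b) = (a <= x + (- c)%:E * b).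
Proof.
move: a b => [a| |]// [b| |]// _ _; rewrite lte_fin => b_gt0.
rewrite inver gt_eqF// lee_pdivlMr// leeBrDr// EFinN mulNe -EFinM leeBrDl//.
Qed.

(** Away from [mu0], multiplying the difference quotient by its positive finite
    denominator turns a lower bound into the inequality on the right. At [mu0]
    both sides of that inequality agree, which allows a full neighbourhood where
    calmness speaks of a punctured one. *)
Lemma calm_from_belowP (R : realType) (P : metricType R) (beta : R -> \bar R)
    (mu0 : P) (h : P -> \bar R)
    (beta_fin : forall t : R, (0 <= t)%R -> beta t \is a fin_num)
    (beta0 : beta 0%R = 0)
    (beta_gt0 : forall t : R, (0 < t)%R -> 0 < beta t) :
  h mu0 \is a fin_num ->
  calm_from_below beta mu0 h <->
  exists lambda : R, (0 <= lambda)%R /\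
    \forall mu \near mu0, h mu0 <= h mu + lambda%:E * beta (mdist mu mu0).
Proof.
move=> h0fin; rewrite /calm_from_below limf_einf_gtNyP.
have quotientE mu c : mu != mu0 ->
    (c%:E <= (h mu - h mu0) / beta (mdist mu mu0)) =
    (h mu0 <= h mu + (- c)%:E * beta (mdist mu mu0)).
  move=> mumu0; rewrite lee_difference_quotient//.
    exact/beta_fin/mdist_ge0.
  by apply: beta_gt0; rewrite mdist_gt0.
split=> [[c]|[lambda [_ hlambda]]].
- rewrite near_withinE => hc; exists (Num.max 0 (- c))%R; split.
    by rewrite le_max lexx.
  apply: filterS hc => mu hc; have [->|mumu0] := eqVneq mu mu0.
    by rewrite mdistxx beta0 mule0 adde0.
  move: (hc mumu0); rewrite quotientE// => /le_trans; apply; rewrite leeD2l//.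
  apply: lee_wpmul2r; last by rewrite lee_fin le_max lexx orbT.
  by rewrite ltW// beta_gt0// mdist_gt0.
- exists (- lambda)%R; rewrite near_withinE.
  by apply: filterS hlambda => mu hmu mumu0; rewrite quotientE// opprK.
Qed.

Lemma penalty_at (R : realType) (X : Type) (P : metricType R)
    (g : X -> P -> \bar R) (beta : R -> \bar R) (mu0 : P) (lambda : R) (x : X) :
  beta 0%R = 0 -> penalty g beta mu0 lambda (x, mu0) = g x mu0.
Proof. by move=> beta0; rewrite /penalty/= mdistxx beta0 mule0 adde0. Qed.

Lemma optimal_value_argmin {R : realType} {X : Type} {P : metricType R}
    {A : set X} {g : X -> P -> \bar R} {mu : P} {x : X} :
  argmin A (g ^~ mu) x -> optimal_value A g mu = g x mu.
Proof.
case=> Ax _ xmin; apply/eqP; rewrite eq_le; apply/andP; split.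
  by apply: ereal_inf_lbound; exists x.
by apply: le_ereal_inf_tmp => _ [y Ay <-]; exact: xmin.
Qed.

(** Exactness demands that every minimizer lie over [mu0]; the free choice of
    lambda reduces this to a plain lower bound for the penalty function, since
    one extra unit of multiplier excludes the minimizers elsewhere. *)
Lemma globally_exactP (R : realType) (X : Type) (P : metricType R)
    (A : set X) (g : X -> P -> \bar R) (beta : R -> \bar R) (mu0 : P)
    (g_gtNy : forall x mu, -oo < g x mu)
    (beta_fin : forall t : R, (0 <= t)%R -> beta t \is a fin_num)
    (beta0 : beta 0%R = 0)
    (beta_gt0 : forall t : R, (0 < t)%R -> 0 < beta t) :
  globally_exact A g beta mu0 <->
  exists x0, argmin A (g ^~ mu0) x0 /\
    exists lambda : R, (0 <= lambda)%R /\
      forall x mu, A x -> g x0 mu0 <= penalty g beta mu0 lambda (x, mu).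
Proof.
split=> [[lambda [lambda0 [[x0 mu] zmin] over]]|].
  have /= mumu0 := over _ zmin; move: zmin; rewrite {}mumu0 => -[[/= Ax0 _]].
  rewrite penalty_at// => x0fin x0min.
  exists x0; split; last first.
    by exists lambda; split=> // x mu' Ax; exact: x0min.
  split=> // y Ay; rewrite -(@penalty_at _ _ _ _ _ _ lambda y beta0).
  exact: x0min.
move=> [x0 [[Ax0 x0fin x0min] [lambda [lambda0 x0le]]]].
have gx0E : g x0 mu0 \is a fin_num by rewrite fin_numElt g_gtNy.
have le_next x mu : penalty g beta mu0 lambda (x, mu) + beta (mdist mu mu0)
    = penalty g beta mu0 (lambda + 1) (x, mu).
  rewrite /penalty/= -addeA EFinD muleDl ?mul1e//.
  exact/beta_fin/mdist_ge0.
have beta_ge0 mu : 0 <= beta (mdist mu mu0).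
  have := mdist_ge0 mu mu0; rewrite le_eqVlt => /predU1P[<-|/beta_gt0/ltW//].
  by rewrite beta0.
exists (lambda + 1)%R; split; first by rewrite addr_ge0.
  exists (x0, mu0); split=> //; rewrite penalty_at// => -[x mu] [/= Ax _].
  by rewrite -le_next (le_trans (x0le _ mu Ax))// leeDl.
move=> [x mu] [[/= Ax _] _ /(_ (x0, mu0))]; rewrite penalty_at// => xmin.
apply: contrapT => /eqP mumu0.
(* Adding beta(d(mu)) > 0 to F_lambda(x, mu) >= g(x0, mu0) exceeds the value
   g(x0, mu0) taken at (x0, mu0); this needs g(x0, mu0) to be finite. *)
have : g x0 mu0 < g x0 mu0.
  rewrite (lt_le_trans _ (xmin (conj Ax0 I)))// -le_next.
  apply: lt_le_trans (leeD2r _ (x0le x mu Ax)).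
  by rewrite lteDl// beta_gt0// mdist_gt0.
by rewrite ltxx.
Qed.

(** Monotonicity of beta keeps beta(d(mu)) away from zero outside a ball around
    [mu0], so there a large multiplier compensates any gap between [v] and the
    lower bound of the penalty function. *)
Lemma penalty_ge_near_to_global (R : realType) (X : Type) (P : metricType R)
    (A : set X) (g : X -> P -> \bar R) (beta : R -> \bar R) (mu0 : P)
    (v lambda0 lambda1 : R)
    (g_gtNy : forall x mu, -oo < g x mu)
    (beta_ge0 : forall t : R, (0 <= t)%R -> 0 <= beta t)
    (beta_fin : forall t : R, (0 <= t)%R -> beta t \is a fin_num)
    (beta_incr : forall s t : R, (0 <= s)%R -> (s < t)%R -> beta s < beta t)
    (lambda1_ge0 : (0 <= lambda1)%R) :
  bounded_below_on (A `*` setT) (penalty g beta mu0 lambda0) ->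
  (\forall mu \near mu0,
    v%:E <= optimal_value A g mu + lambda1%:E * beta (mdist mu mu0)) ->
  exists lambda : R, (0 <= lambda)%R /\
    forall x mu, A x -> v%:E <= penalty g beta mu0 lambda (x, mu).
Proof.
move=> [c cle] /nbhs_ballP[delta /= delta0 nearle].
have betaE t : (0 <= t)%R -> beta t = (fine (beta t))%:E.
  by move=> t0; rewrite fineK// beta_fin.
set r := fine (beta delta).
have r_gt0 : (0 < r)%R.
  rewrite -lte_fin -betaE ?(ltW delta0)//.
  by rewrite (le_lt_trans (beta_ge0 0%R _))// beta_incr.
(* Chosen so that m * b >= v - c for every b >= r: adding m to the multiplier
   lifts the lower bound c to v wherever beta(d(mu)) >= beta(delta). *)
set m := Num.max 0%R ((v - c) / r)%R.
have m_ge0 : (0 <= m)%R by rewrite le_max lexx.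
have m_ge : (v - c <= m * r)%R by rewrite -ler_pdivrMr// le_max lexx orbT.
set lambda := Num.max lambda1 (lambda0 + m)%R.
have lambda_ge1 : (lambda1 <= lambda)%R by rewrite le_max lexx.
have lambda_ge0 : (lambda0 + m <= lambda)%R by rewrite le_max lexx orbT.
exists lambda; split; first exact: le_trans lambda_ge1.
move=> x mu Ax; rewrite /penalty/=.
have d_ge0 := mdist_ge0 mu mu0.
have [mudelta|deltamu] := ltP (mdist mu mu0) delta.
- have /nearle/= /le_trans : ball mu0 delta mu.
    by rewrite ballEmdist/= metric_sym.
  apply; apply: leeD; first by apply: ereal_inf_lbound; exists x.
  by apply: lee_wpmul2r; rewrite ?beta_ge0 ?lee_fin.
- have := cle (x, mu) (conj Ax I); rewrite /penalty/=.
  have : beta delta <= beta (mdist mu mu0).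
    move: deltamu; rewrite le_eqVlt => /predU1P[->//|/beta_incr].
    by move=> /(_ (ltW delta0))/ltW.
  rewrite (betaE _ (ltW delta0)) (betaE _ d_ge0) -/r; set b := fine _; rewrite lee_fin => rb.
  have := g_gtNy x mu; case: (g x mu) => [e| |]// _; last first.
    by rewrite addye ?leey// -EFinM.
  rewrite -!EFinM -!EFinD !lee_fin => ce.
  have mb : (m * r <= m * b)%R by rewrite ler_wpM2l.
  have lb : ((lambda0 + m) * b <= lambda * b)%R.
    by rewrite ler_wpM2r// (le_trans _ rb)// ltW.
  rewrite mulrDl in lb; lra.
Qed.

Theorem theorem1 (R : realType) (X : topologicalType) (P : metricType R)
    (f : X -> \bar R) (M A : set X)
    (g : X -> P -> \bar R) (mu0 : P) (beta : R -> \bar R)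
    (f_gtNy : forall x, -oo < f x)
    (MA_neq0 : M `&` A !=set0)
    (f_bounded_below : bounded_below_on (M `&` A) f)
    (g_gtNy : forall x mu, -oo < g x mu)
    (consistency : forall x, (M `&` A) x -> g x mu0 = f x)
    (exact_penalization :
       argmin A (fun x => g x mu0) = argmin (M `&` A) f)
    (beta_ge0 : forall t : R, (0 <= t)%R -> 0 <= beta t)
    (beta_eq0 : forall t : R, (0 <= t)%R -> (beta t = 0 <-> t = 0%R))
    (beta_strictly_increasing :
       forall s t : R, (0 <= s)%R -> (s < t)%R -> beta s < beta t) :
  globally_exact A g beta mu0 <->
  [/\ argmin (M `&` A) f !=set0,
      calm_from_below beta mu0 (optimal_value A g)
    & exists lambda0 : R,
        (0 <= lambda0)%R /\
        bounded_below_on (A `*` setT) (penalty g beta mu0 lambda0)].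
Proof.
have beta_fin :=
  fin_num_strictly_increasing _ _ beta_ge0 beta_strictly_increasing.
have beta0 : beta 0%R = 0 by apply/beta_eq0.
have beta_gt0 (t : R) : (0 < t)%R -> 0 < beta t.
  by rewrite -beta0; exact: beta_strictly_increasing.
have gfin x : argmin A (g ^~ mu0) x -> g x mu0 \is a fin_num.
  by case=> _ gx _; rewrite fin_numElt g_gtNy.
rewrite -exact_penalization globally_exactP//; split.
- move=> [x0 [x0min [lambda [lambda0 x0le]]]]; split; first by exists x0.
  + rewrite calm_from_belowP ?(optimal_value_argmin x0min) ?gfin//.
    exists lambda; split=> //; apply: nearW => mu.
    rewrite -leeBlDr; last by rewrite fin_numM// beta_fin// mdist_ge0.
    apply: le_ereal_inf_tmp => _ [x Ax <-].
    rewrite leeBlDr; last by rewrite fin_numM// beta_fin// mdist_ge0.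
    exact: x0le.
  + exists lambda; split=> //; exists (fine (g x0 mu0)) => -[x mu] [/= Ax _].
    by rewrite fineK ?gfin//; exact: x0le.
- move=> [[x0 x0min]]; have hE := optimal_value_argmin x0min.
  rewrite calm_from_belowP ?hE ?gfin// => -[lambda1 [lambda1_ge0 nearle]].
  move=> [lambda0 [_ bounded]]; exists x0; split=> //.
  move: nearle; rewrite -(fineK (gfin _ x0min)) => nearle.
  by apply: penalty_ge_near_to_global lambda1_ge0 bounded nearle.
Qed.
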